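(* For every integer $n\ge 1$, the second factorial moment of the area statistic on parking functions of length $n$ is $$\mathbb{E}\big[\mathrm{Area}(\mathrm{Area}-1)\big] \;=\; -\frac{7}{3}(n+1)\,E_1(n)+\frac{5}{12}n^{3}-\frac{1}{12}n^{2}-\frac{1}{3}n ,$$ and asymptotically it equals $\frac{5}{12}n^{3}+O(n^{5/2})$ as $n\to\infty$.
   Context: A parking function of length $n$ is a vector $(p_1,\dots,p_n)$ of positive integers such that its weakly increasing rearrangement $p_{(1)}\le p_{(2)}\le\dots\le p_{(n)}$ satisfies $p_{(i)}\le i$ for all $1\le i\le n$. There are $(n+1)^{n-1}$ of them. The area statistic is $\mathrm{Area}(p)=\frac{n(n+1)}{2}-\sum_{i=1}^n p_i$. Expectations are taken with respect to the uniform distribution on the set of parking functions of length $n$; the $k$-th factorial moment is $\mathbb{E}[\mathrm{Area}(\mathrm{Area}-1)\cdots(\mathrm{Area}-k+1)]$. Here $E_1(n)$ denotes $$E_1(n)= -\frac{n}{2}+\frac{1}{2}\,\frac{(n+1)!}{(n+1)^{n}}\sum_{k=0}^{n-1}\frac{(n+1)^k}{k!},$$ which is the expectation of the area statistic on parking functions of length $n$. *)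

(* Defs.v *)
From mathcomp Require Import all_boot all_order all_algebra.
From mathcomp Require Import all_classical all_reals all_analysis.
Set Implicit Arguments.
Unset Strict Implicit.
Unset Printing Implicit Defensive.
Import Order.TTheory GRing.Theory Num.Theory.
Import numFieldNormedType.Exports.
Local Open Scope ring_scope.

(* Indices start at 0 here, so p_(i) <= i for 1 <= i <= n reads
   nth 0 (sort leq p) i <= i.+1 for i < n. *)
Definition is_parking (n : nat) (p : n.-tuple nat) : bool :=
  all (leq 1) p && [forall i : 'I_n, (nth 0 (sort leq p) i <= i.+1)%N].

(* The entries of a parking function of length n are at most n, so nothing is
   lost by taking them in the finite type 'I_n.+1: see parking_funsP. *)
Definition parking_funs (n : nat) : {set n.-tuple 'I_n.+1} :=
  [set p | is_parking (map_tuple val p)].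

Lemma parking_funsP (n : nat) (p : n.-tuple nat) :
  reflect (exists2 q, q \in parking_funs n & p = map_tuple val q)
          (is_parking p).
Proof.
apply: (iffP idP) => [pp|[q + ->]]; last by rewrite inE.
have le_p x : x \in p -> (x <= n)%N.
  rewrite -(mem_sort leq) => xp; case/andP: pp => _ /forallP le_s.
  have lt_x : (index x (sort leq p) < n)%N.
    by rewrite -[X in (_ < X)%N](size_tuple p) -(size_sort leq) index_mem.
  by have := le_s (Ordinal lt_x); rewrite /= nth_index// => /leq_trans; apply.
have eq_p : p = map_tuple val (map_tuple (@inord n) p).
  apply: val_inj => /=; rewrite -map_comp -[LHS]map_id.
  by apply/eq_in_map => x /le_p le_x /=; rewrite inordK.
by exists (map_tuple (@inord n) p) => //; rewrite inE -eq_p.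
Qed.

Definition parking_expectation (R : realType) (n : nat)
    (X : n.-tuple nat -> R) : R :=
  (\sum_(p in parking_funs n) X (map_tuple val p)) / #|parking_funs n|%:R.

Definition area (R : realType) (n : nat) (p : n.-tuple nat) : R :=
  n%:R * (n%:R + 1) / 2 - \sum_(i < n) (tnth p i)%:R.

Definition area_moment2 (R : realType) (n : nat) : R :=
  parking_expectation (fun p : n.-tuple nat => area R p * (area R p - 1)).

Definition E1 (R : realType) (n : nat) : R :=
  - (n%:R / 2) + 1 / 2 * ((n.+1)`!%:R / n.+1%:R ^+ n)
                 * \sum_(0 <= k < n) n.+1%:R ^+ k / k`!%:R.

(* Main.v *)
Require Import Defs.
From mathcomp Require Import all_boot all_order all_algebra.
From mathcomp Require Import all_classical all_reals all_analysis.
From mathcomp Require Import ring lra zify.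
Set Implicit Arguments.
Unset Strict Implicit.
Unset Printing Implicit Defensive.
Import Order.TTheory GRing.Theory Num.Theory.
Import numFieldNormedType.Exports.
Local Open Scope classical_set_scope.
Local Open Scope ring_scope.

(* For words w of length n over {0, 1, ...} whose increasing rearrangement
   satisfies a_i < x + i, let M_r(n, x) be the sum of (sum of w)^r. Deleting the
   k letters 0 and shifting the others down gives
     M_r(n, x) = \sum_k C(n, k) \sum_w' (sum of w' + (n - k))^r
   where w' ranges over the words for (n - k, x + k - 1). The quantity c = n + x
   drops by exactly 1 (for x > 0), so that if M_r(n, x) / n! = [t^n] exp(c t) B_r,c(t) the
   recurrence reads, with D = t d/dt,
     B_0,c+1 = B_0,c,
     B_1,c+1 = B_1,c + (c t + D) B_0,c,
     B_2,c+1 = B_2,c + 2 (c t + D) B_1,c + (c t + D)^2 B_0,c,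
   and M_r(n, 0) = 0 for n > 0 fixes the solution: B_0 = 1 - t, and B_1, B_2 are
   combinations of powers of 1 - t with coefficients polynomial in c. At x = 1 the
   relation n [t^n] y = [t^n] D y for y = exp(c t) / (1 - t)^k reduces everything
   to [t^n] exp(c t) and [t^n] exp(c t) / (1 - t), the latter being the sum in E1
   with the term k = n added.
   The error term needs no asymptotics of that sum: (E Area)^2 <= E Area^2 is a
   quadratic inequality for E1, which yields E1 = O(n^(3/2)). *)

(** * Sums over words, split by their zeros *)

Section WordSums.
Variable R : comNzRingType.
Implicit Types (F G : seq nat -> R) (w : seq nat).

Fixpoint word_sum (K n : nat) F : R :=
  if n is m.+1 then \sum_(a < K) word_sum K m (fun w => F (val a :: w))
  else F [::].

Lemma eq_word_sum K n F G :
  (forall w, size w = n -> F w = G w) -> word_sum K n F = word_sum K n G.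
Proof.
elim: n F G => [|n IHn] F G eqFG /=; first exact: eqFG.
by apply: eq_bigr => a _; apply: IHn => w sz_w; apply: eqFG; rewrite /= sz_w.
Qed.

Lemma word_sum0 K n F :
  (forall w, size w = n -> F w = 0) -> word_sum K n F = 0.
Proof.
elim: n F => [|n IHn] F F0 /=; first exact: F0.
by rewrite big1// => a _; apply: IHn => w sz_w; apply: F0; rewrite /= sz_w.
Qed.

Lemma word_sumD K n F G :
  word_sum K n (fun w => F w + G w) = word_sum K n F + word_sum K n G.
Proof.
elim: n F G => [//|n IHn] F G /=; rewrite -big_split.
by apply: eq_bigr => a _; rewrite IHn.
Qed.

Lemma word_sumZ K n (c : R) F :
  word_sum K n (fun w => c * F w) = c * word_sum K n F.
Proof.
elim: n F => [//|n IHn] F /=; rewrite mulr_sumr.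
by apply: eq_bigr => a _; rewrite IHn.
Qed.

Lemma word_sum_tuple K n F :
  \sum_(t : n.-tuple 'I_K) F (map val t) = word_sum K n F.
Proof.
elim: n F => [|n IHn] F /=.
  by rewrite (big_pred1 [tuple]) //= => t; apply/esym/eqP/tuple0.
under [RHS]eq_bigr do rewrite -IHn.
rewrite pair_big/=.
rewrite (reindex (fun p : 'I_K * n.-tuple 'I_K => [tuple of p.1 :: p.2])) //=.
exists (fun t : n.+1.-tuple 'I_K => (thead t, [tuple of behead t])).
  by move=> [a t] _ /=; rewrite theadE; congr pair; apply: val_inj.
by move=> t _; rewrite -tuple_eta.
Qed.

Definition zeros w : nat := count_mem 0%N w.

Definition unshift w : seq nat := [seq x.-1 | x <- w & x != 0%N].

(** The binomial coefficient counts the positions of the zeros. The induction peels off the first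
    letter: a 0 raises k by 1, any other letter keeps it, and Pascal's rule merges the two cases. *)
Lemma word_sum_split K n (F : nat -> seq nat -> R) :
  word_sum K.+1 n (fun w => F (zeros w) (unshift w)) =
  \sum_(k < n.+1) 'C(n, k)%:R * word_sum K (n - k) (F k).
Proof.
elim: n F => [|n IHn] F; first by rewrite big_ord_recl big_ord0 /= mul1r addr0.
rewrite [LHS]/= big_ord_recl /= (IHn (fun k w => F k.+1 w)).
under [in X in _ + X]eq_bigr => a _ do rewrite (IHn (fun k w => F k (val a :: w))).
rewrite exchange_big/=.
under [in X in _ + X]eq_bigr => k _.
  rewrite -mulr_sumr -[X in _ * X]/(word_sum K (n - k).+1 (F k)) -subSn -1?ltnS//.
  over.
rewrite [in X in _ + X]big_ord_recl [RHS]big_ord_recl /= !bin0 addrCA; congr (_ + _).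
(* The added top term has coefficient ['C(n, n.+1)], which is 0; both sums now have the range that
   [binS] needs. *)
have -> : \sum_(i < n) 'C(n, bump 0 i)%:R * word_sum K (n.+1 - bump 0 i) (F (bump 0 i))
    = \sum_(i < n.+1) 'C(n, i.+1)%:R * word_sum K (n - i) (F i.+1).
  rewrite [RHS]big_ord_recr /= bin_small// mul0r addr0.
  by apply: eq_bigr => i _.
rewrite -big_split; apply: eq_bigr => i _ /=.
by rewrite /bump /= add1n subSS binS natrD mulrDl addrC.
Qed.

End WordSums.

(** * Parking words and the removal of their zeros *)

Lemma size_unshift w : (zeros w + size (unshift w) = size w)%N.
Proof. by elim: w => [//|[|a] w] /=; rewrite /unshift /zeros /= => <-; lia. Qed.

Lemma sumn_unshift w : (sumn (unshift w) + size (unshift w) = sumn w)%N.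
Proof. by elim: w => [//|[|a] w] /=; rewrite /unshift /zeros /= => <-; lia. Qed.

Lemma count_unshift w v :
  (zeros w + count (gtn v) (unshift w) = count (gtn v.+1) w)%N.
Proof. by elim: w => [//|[|a] w] /=; rewrite /unshift /zeros /= => <-; lia. Qed.

(* The words whose increasing rearrangement a_0 <= a_1 <= ... satisfies
   a_i < x + i: for x = 1, parking functions with entries shifted down by 1. *)
Definition parking_word (x : nat) (w : seq nat) : bool :=
  [forall v : 'I_(x + size w), v < x + count (gtn v) w]%N.

Lemma parking_wordP x w :
  reflect (forall v, v < x + size w -> v < x + count (gtn v) w)%N (parking_word x w).
Proof.
apply: (iffP forallP) => [H v lt_v|H v]; last exact: H.
exact: (H (Ordinal lt_v)).
Qed.

Lemma parking_word0 w : size w != 0%N -> parking_word 0 w = false.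
Proof.
move=> w0; apply/parking_wordP => /(_ 0%N); rewrite !add0n lt0n => /(_ w0).
by rewrite (@eq_count _ _ pred0) ?count_pred0.
Qed.

(** By [count_unshift], the condition at v + 1 for w is the condition at v for [unshift w], the
    zeros being moved into x. The condition at 0 for w is vacuous because x + 1 > 0. *)
Lemma parking_word_unshift x w :
  parking_word x.+1 w = parking_word (x + zeros w) (unshift w).
Proof.
have sz := size_unshift w; apply/parking_wordP/parking_wordP => H v lt_v.
  by have := H v.+1; rewrite -count_unshift; lia.
by case: v lt_v => // v lt_v; have := H v; rewrite -count_unshift; lia.
Qed.

(** The sorted letter at index i is below v exactly when more than i letters are below v; take v = x
    + i. *)
Lemma parking_word_sort x w :
  parking_word x w = [forall i : 'I_(size w), nth 0%N (sort leq w) i < x + i]%N.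
Proof.
have ss : sorted <=%O (sort leq w) by apply: sort_sorted; exact: leq_total.
have cnt v : count (gtn v) w = count (gtn v) (sort leq w).
  by apply/permP; rewrite perm_sym perm_sort.
have lt_nth v i : (i < count (gtn v) w -> nth 0 (sort leq w) i < v)%N.
  by rewrite cnt; apply: (@nth_count_lt _ _ v).
have ge_nth v i : (count (gtn v) w <= i < size w -> v <= nth 0 (sort leq w) i)%N.
  by rewrite cnt -(size_sort leq w); apply: (@nth_count_ge _ _ v).
apply/parking_wordP/forallP => [H i|H v lt_v].
  by apply: lt_nth; have := H (x + i)%N; have := ltn_ord i; lia.
rewrite ltnNge; apply/negP => le_v.
have lt_i : (v - x < size w)%N by lia.
by have := H (Ordinal lt_i); have := ge_nth v (v - x)%N; rewrite /=; lia.
Qed.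

(** * Coefficients of exp (c t) times powers of 1 - t *)

Section ExpSequences.
Variable R : numFieldType.
Implicit Types (f g : nat -> R) (b : seq R) (c : R) (m n : nat).

(** On generating functions, [partial_sum] divides by 1 - t, [backward_diff] multiplies by 1 - t,
    and [exp_convol] multiplies by exp t. *)
Definition partial_sum f n : R := \sum_(i < n.+1) f i.

Definition backward_diff f n : R := if n is m.+1 then f n - f m else f n.

Definition exp_convol f n : R := \sum_(k < n.+1) f (n - k)%N / k`!%:R.

Lemma partial_sumS f n : partial_sum f n.+1 = partial_sum f n + f n.+1.
Proof. by rewrite /partial_sum big_ord_recr. Qed.

Lemma partial_sumK f : backward_diff (partial_sum f) =1 f.
Proof.
move=> [|n] /=; first by rewrite /partial_sum big_ord1.
by rewrite partial_sumS addrC addKr.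
Qed.

Lemma backward_diffK f : partial_sum (backward_diff f) =1 f.
Proof.
rewrite /partial_sum; elim=> [|n IHn]; first by rewrite big_ord1.
by rewrite big_ord_recr IHn /= subrKC.
Qed.

Lemma backward_diff_inj f g : backward_diff f =1 backward_diff g -> f =1 g.
Proof.
move=> eq_fg n; rewrite -(backward_diffK f n) -(backward_diffK g n).
by apply: eq_bigr => i _; rewrite eq_fg.
Qed.

Lemma eq_exp_convol f g : f =1 g -> exp_convol f =1 exp_convol g.
Proof. by move=> fg n; apply: eq_bigr => k _; rewrite fg. Qed.

Lemma exp_convol_diff f :
  exp_convol (backward_diff f) =1 backward_diff (exp_convol f).
Proof.
case=> [|n]; first by rewrite /= /exp_convol !big_ord1.
rewrite /exp_convol /= big_ord_recr [X in _ = X - _]big_ord_recr /= !subnn.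
rewrite addrAC -sumrB; congr (_ + _).
apply: eq_bigr => i _; rewrite subSn; last by rewrite -ltnS.
by rewrite /= mulrBl.
Qed.

Lemma exp_convol_sum f : exp_convol (partial_sum f) =1 partial_sum (exp_convol f).
Proof.
apply: backward_diff_inj => n; rewrite -exp_convol_diff partial_sumK.
exact/eq_exp_convol/partial_sumK.
Qed.

Definition exp_coef c n : R := c ^+ n / n`!%:R.

(* [exp_quot c m n] is the coefficient of [t^n] in the power series
   [exp (c t) / (1 - t)^(m - 3)]. *)
Definition exp_quot c m : nat -> R :=
  iter m partial_sum (iter 3 backward_diff (exp_coef c)).

Lemma fact_neq0 n : n`!%:R != 0 :> R.
Proof. by rewrite pnatr_eq0 -lt0n fact_gt0. Qed.

Lemma exp_convol_coef c : exp_convol (exp_coef c) =1 exp_coef (c + 1).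
Proof.
move=> n; rewrite /exp_convol /exp_coef exprDn mulr_suml.
apply: eq_bigr => k _; rewrite expr1n mulr1.
have le_kn : (k <= n)%N by rewrite -ltnS.
rewrite -[_ *+ 'C(n, k)]mulr_natr -(bin_fact le_kn) !natrM.
have := fact_neq0 k; have := fact_neq0 (n - k).
have : 'C(n, k)%:R != 0 :> R by rewrite pnatr_eq0 -lt0n bin_gt0.
move: 'C(n, k)%:R (k`!)%:R ((n - k)`!)%:R => x y z x0 z0 y0.
by field; rewrite x0 y0 z0.
Qed.

Lemma exp_convol_quot c m : exp_convol (exp_quot c m) =1 exp_quot (c + 1) m.
Proof.
elim: m => [|m IHm] n /=.
  have step f g : exp_convol f =1 g ->
      exp_convol (backward_diff f) =1 backward_diff g.
    by move=> fg [|k]; rewrite exp_convol_diff /= !fg.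
  by do 3!apply: (step); apply: exp_convol_coef.
by rewrite exp_convol_sum; apply: eq_bigr => i _; rewrite IHm.
Qed.

(* Coefficientwise form of the differential equation
   [t y' = c (1 - (1 - t)) y + k (1 / (1 - t) - 1) y] of
   [y = exp (c t) / (1 - t)^k]. *)
Let euler c (k : R) f := forall n,
  n%:R * f n = c * (f n - backward_diff f n) + k * (partial_sum f n - f n).

Lemma euler_coef c : euler c 0 (exp_coef c).
Proof.
move=> [|n] /=; rewrite [0 * (_ - _)]mul0r addr0; first by rewrite mul0r subrr mulr0.
rewrite opprB addrCA subrr addr0 /exp_coef exprS factS natrM.
have := fact_neq0 n; have : n.+1%:R != 0 :> R by rewrite pnatr_eq0.
by move: n.+1%:R n`!%:R => x y x0 y0; field; rewrite x0 y0.
Qed.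

(** Product rule: a factor 1 - t adds - t / (1 - t) to t y' / y, which lowers k by 1. Dividing by 1
    - t raises it in [euler_sum]. *)
Lemma euler_diff c (k : R) (f : nat -> R) :
  euler c k f -> euler c (k - 1) (backward_diff f).
Proof.
move=> ef n; rewrite backward_diffK; case: n => [|n].
  by have := ef 0%N; rewrite /partial_sum big_ord1 /= => ->; ring.
have := ef n.+1; have := ef n; rewrite partial_sumS /= -natr1.
move: (partial_sum f n) (f n.+1) (f n) (backward_diff f n) => s x y d e1 e2.
suff -> : (n%:R + 1) * (x - y) = (n%:R + 1) * x - n%:R * y - y by rewrite e2 e1; ring.
ring.
Qed.

Lemma euler_sum c (k : R) (f : nat -> R) :
  euler c k f -> euler c (k + 1) (partial_sum f).
Proof.
move=> ef n; rewrite partial_sumK; elim: n => [|n IHn].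
  by rewrite /partial_sum !big_ord1 /=; ring.
have := ef n.+1; rewrite !partial_sumS /= -natr1 => e.
rewrite mulrDr e [(_ + 1) * _]mulrDl IHn; ring.
Qed.

Lemma exp_quot_euler c m n :
  n%:R * exp_quot c m.+1 n =
  c * (exp_quot c m.+1 n - exp_quot c m n)
  + (m%:R - 2) * (exp_quot c m.+2 n - exp_quot c m.+1 n).
Proof.
suff : euler c (m%:R - 2) (exp_quot c m.+1).
  by move=> /(_ n); rewrite {2}/exp_quot iterS partial_sumK.
elim: m => [|m IHm]; last first.
  by rewrite -natr1 addrAC; apply: euler_sum.
have eq_euler k f g : f =1 g -> euler c k f -> euler c k g.
  move=> fg ef i; rewrite -!fg ef; congr (_ * (_ - _) + _ * (_ - _)).
    by case: i => [|i]; rewrite /= !fg.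
  by apply: eq_bigr => j _; rewrite fg.
apply: (@eq_euler _ (iter 2 backward_diff (exp_coef c))).
  by move=> i; apply/esym; exact: (backward_diffK (iter 2 backward_diff (exp_coef c))).
have -> : 0%:R - 2 = 0 - 1 - 1 :> R by ring.
by do 2!apply: euler_diff; apply: euler_coef.
Qed.

Lemma exp_quot3 c n : exp_quot c 3 n = exp_coef c n.
Proof.
rewrite /exp_quot.
have step f g : f =1 backward_diff g -> partial_sum f =1 g.
  by move=> fg i; rewrite -[RHS]backward_diffK; apply: eq_bigr => j _; rewrite fg.
by do 3!apply: (step).
Qed.

Lemma exp_quot0n c m : exp_quot c m 0 = 1.
Proof.
elim: m => [|m IHm]; first by rewrite /exp_quot /= /exp_coef expr0 divr1.
by rewrite [LHS]/partial_sum big_ord1.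
Qed.

Definition exp_quot_comb c b n : R := \sum_(m < size b) b`_m * exp_quot c m n.

Lemma exp_convol_comb c b : exp_convol (exp_quot_comb c b) =1 exp_quot_comb (c + 1) b.
Proof.
move=> n; rewrite /exp_convol /exp_quot_comb.
under eq_bigr do rewrite mulr_suml.
rewrite exchange_big; apply: eq_bigr => m _ /=.
by rewrite -exp_convol_quot mulr_sumr; apply: eq_bigr => k _; rewrite mulrA.
Qed.

End ExpSequences.

Arguments exp_quot : simpl never.

Ltac expand_comb := rewrite /exp_quot_comb !big_ord_recl !big_ord0 /= /bump /=.

(** * Closed forms for the moments of the letter sum *)

Section Moments.
Variable R : numFieldType.

(* M_r(n, x), with letters < K; nothing is lost as soon as n + x <= K + 1. *)
Definition word_moment (r K n x : nat) : R :=
  word_sum K n (fun w => if parking_word x w then (sumn w)%:R ^+ r else 0).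

Lemma word_moment_nil r K x : word_moment r K 0 x = 0 ^+ r.
Proof.
rewrite /word_moment /= ifT//; apply/parking_wordP => v.
by rewrite /= !addn0.
Qed.

Lemma word_moment_x0 r K n : word_moment r K n.+1 0 = 0.
Proof. by apply: word_sum0 => w sz_w; rewrite parking_word0 ?sz_w. Qed.

Lemma word_moment_split r K n x :
  word_moment r K.+1 n x.+1 =
  \sum_(k < n.+1) 'C(n, k)%:R * word_sum K (n - k)
    (fun w => if parking_word (x + k) w then (sumn w + (n - k))%:R ^+ r else 0).
Proof.
rewrite /word_moment.
under eq_word_sum => w _ do rewrite parking_word_unshift -sumn_unshift.
rewrite (word_sum_split K n (fun k w =>
  if parking_word (x + k) w then (sumn w + size w)%:R ^+ r else 0)).
by apply: eq_bigr => k _; congr (_ * _); apply: eq_word_sum => w ->.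
Qed.

Lemma word_moment0_split K n x :
  word_moment 0 K.+1 n x.+1 =
  \sum_(k < n.+1) 'C(n, k)%:R * word_moment 0 K (n - k) (x + k).
Proof. by rewrite word_moment_split. Qed.

Lemma word_moment1_split K n x :
  word_moment 1 K.+1 n x.+1 =
  \sum_(k < n.+1) 'C(n, k)%:R *
    (word_moment 1 K (n - k) (x + k)
     + (n - k)%:R * word_moment 0 K (n - k) (x + k)).
Proof.
rewrite word_moment_split; apply: eq_bigr => k _; congr (_ * _).
rewrite -word_sumZ -word_sumD; apply: eq_word_sum => w _.
by case: ifP => _; rewrite ?natrD; ring.
Qed.

Lemma word_moment2_split K n x :
  word_moment 2 K.+1 n x.+1 =
  \sum_(k < n.+1) 'C(n, k)%:R *
    (word_moment 2 K (n - k) (x + k)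
     + 2 * (n - k)%:R * word_moment 1 K (n - k) (x + k)
     + (n - k)%:R ^+ 2 * word_moment 0 K (n - k) (x + k)).
Proof.
rewrite word_moment_split; apply: eq_bigr => k _; congr (_ * _).
rewrite -!word_sumZ -!word_sumD; apply: eq_word_sum => w _.
by case: ifP => _; rewrite ?natrD; ring.
Qed.

(* The coefficients of B_r,c in the basis (1 - t)^3, (1 - t)^2, 1 - t, 1,
   1 / (1 - t), ... *)
Definition moment_coef0 : seq R := [:: 0; 0; 1].

Definition moment_coef1 (c : R) : seq R :=
  [:: 0; (c - c ^+ 2) / 2; (c ^+ 2 + c - 1) / 2; 1 / 2 - c; - (1 / 2); 1 / 2].

Definition moment_coef2 (c : R) : seq R :=
  [:: (c ^+ 4 - 2 * c ^+ 3 + c ^+ 2) / 4;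
      - (2 / 3) * c + 3 / 2 * c ^+ 2 - c ^+ 3 / 3 - c ^+ 4 / 2;
      1 / 6 + c / 6 - 9 / 4 * c ^+ 2 + 11 / 6 * c ^+ 3 + c ^+ 4 / 4;
      - (1 / 6) + c ^+ 2 - c ^+ 3;
      - (1 / 2) + 2 * c - c ^+ 2;
      17 / 6 - 7 / 2 * c + c ^+ 2 / 2;
      2 * c - 22 / 3; 9; - 4].

Lemma comb_coef0 (c : R) n : exp_quot_comb c moment_coef0 n = exp_quot c 2 n.
Proof. by expand_comb; ring. Qed.

(** Multiplying the n-th coefficient by n is D, and D (exp (c t) B) = exp (c t) (c t + D) B; this is
    the recurrence for B_1. *)
Lemma moment1_step (c : R) n :
  exp_quot_comb c (moment_coef1 c) n + n%:R * exp_quot_comb c moment_coef0 n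
  = exp_quot_comb c (moment_coef1 (c + 1)) n.
Proof. by rewrite comb_coef0 exp_quot_euler; expand_comb; field. Qed.

Lemma moment2_step (c : R) n :
  exp_quot_comb c (moment_coef2 c) n
  + 2 * n%:R * exp_quot_comb c (moment_coef1 c) n
  + n%:R ^+ 2 * exp_quot_comb c moment_coef0 n
  = exp_quot_comb c (moment_coef2 (c + 1)) n.
Proof.
(* Each [d m] is an Euler relation, hence 0, and the difference of the two sides is a combination of
   them. Its coefficients come from twice [moment_coef1 c], corrected by - c, c + 1 and - 1, which
   arise when n times the relation for [exp_quot c 2] is expanded. *)
pose d m := n%:R * exp_quot c m.+1 n
  - (c * (exp_quot c m.+1 n - exp_quot c m n)
     + (m%:R - 2) * (exp_quot c m.+2 n - exp_quot c m.+1 n)).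
have d0 m : d m = 0 by rewrite /d exp_quot_euler subrr.
apply/eqP; rewrite -subr_eq0; apply/eqP.
(* The summand n * d 1 linearises the term n^2 * exp_quot c 2 n. *)
transitivity ((c - c ^+ 2 - c) * d 0%N + (c ^+ 2 + c - 1 + n%:R + c + 1) * d 1%N
              + (1 - 2 * c - 1) * d 2%N - d 3%N + d 4%N); last first.
  by rewrite !d0 !mulr0 subr0 !addr0.
by rewrite comb_coef0; expand_comb; rewrite /d; field.
Qed.

(** When the degree equals c, the term [c * exp_quot c m.+1] cancels from both sides of
    [exp_quot_euler]. *)
Lemma exp_quot_diag n m : let c := n.+1%:R : R in
  exp_quot c m n.+1 = (m%:R - 2) * (exp_quot c m.+2 n.+1 - exp_quot c m.+1 n.+1) / c.
Proof.
move=> c; have c0 : c != 0 by rewrite pnatr_eq0.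
have := exp_quot_euler c m n.+1; rewrite -/c => e.
apply: (mulfI c0); rewrite [RHS]mulrC divfK //.
move: e; move: (exp_quot c m.+1 _) (exp_quot c m.+2 _) (exp_quot c m _) => u v w e.
transitivity (c * u - (c * (u - w) + (m%:R - 2) * (v - u)) + (m%:R - 2) * (v - u)).
  by ring.
by rewrite {1}e subrr add0r.
Qed.

(** This and the next two lemmas are the boundary case x = 0, where c is the length of the words. *)
Lemma moment0_eq0 n : exp_quot_comb n.+1%:R moment_coef0 n.+1 = 0 :> R.
Proof. by rewrite comb_coef0 exp_quot_diag subrr !mul0r. Qed.

Lemma moment1_eq0 n : exp_quot_comb n.+1%:R (moment_coef1 n.+1%:R) n.+1 = 0 :> R.
Proof.
expand_comb; have : n.+1%:R != 0 :> R by rewrite pnatr_eq0.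
rewrite !(exp_quot_diag n 0, exp_quot_diag n 1, exp_quot_diag n 2, exp_quot_diag n 3).
by move: n.+1%:R (exp_quot _ _ _) (exp_quot _ _ _) => c a b c0; field.
Qed.

Lemma moment2_eq0 n : exp_quot_comb n.+1%:R (moment_coef2 n.+1%:R) n.+1 = 0 :> R.
Proof.
expand_comb; have : n.+1%:R != 0 :> R by rewrite pnatr_eq0.
have e := exp_quot_diag n; rewrite (e 0) (e 1%N) (e 2%N) (e 3%N) (e 4%N) (e 5%N) (e 6%N).
by move=> c0; field.
Qed.

(** Induction on the alphabet size. Removing k zeros takes (n, x + 1) to (n - k, x + k), whose sum
    does not depend on k; so all terms share the parameter d = c - 1 and the sum over k is one
    convolution with exp t. *)
Lemma word_momentE K n x : (n + x <= K.+1)%N ->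
  let c := (n + x)%:R : R in
  [/\ word_moment 0 K n x = n`!%:R * exp_quot_comb c moment_coef0 n,
      word_moment 1 K n x = n`!%:R * exp_quot_comb c (moment_coef1 c) n
    & word_moment 2 K n x = n`!%:R * exp_quot_comb c (moment_coef2 c) n].
Proof.
elim: K n x => [|K IHK] [|n] [|x] le_nx c.
all: try by rewrite !word_moment_nil !mul1r; split; expand_comb;
  rewrite !exp_quot0n; field.
all: try by rewrite !word_moment_x0 /c addn0 moment0_eq0 moment1_eq0 moment2_eq0 !mulr0.
  by lia.
pose d : R := (n.+1 + x)%:R.
have cE : c = d + 1 by rewrite /c addnS natr1.
have split_fact (k : 'I_n.+2) :
    'C(n.+1, k)%:R * (n.+1 - k)`!%:R = n.+1`!%:R / k`!%:R :> R.
  have le_kn : (k <= n.+1)%N by rewrite -ltnS.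
  by rewrite -(bin_fact le_kn) !natrM; field; rewrite fact_neq0.
have conv (b : seq R) : \sum_(k < n.+2) 'C(n.+1, k)%:R *
    ((n.+1 - k)`!%:R * exp_quot_comb d b (n.+1 - k))
  = n.+1`!%:R * exp_quot_comb c b n.+1.
  rewrite cE -exp_convol_comb mulr_sumr; apply: eq_bigr => k _.
  by rewrite mulrA split_fact mulrAC mulrA.
have IH (k : 'I_n.+2) : let m := (n.+1 - k)%N in
   [/\ word_moment 0 K m (x + k) = m`!%:R * exp_quot_comb d moment_coef0 m,
       word_moment 1 K m (x + k) = m`!%:R * exp_quot_comb d (moment_coef1 d) m
     & word_moment 2 K m (x + k) = m`!%:R * exp_quot_comb d (moment_coef2 d) m].
  have mx : (n.+1 - k + (x + k) = n.+1 + x)%N by have := ltn_ord k; lia.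
  by have := IHK (n.+1 - k)%N (x + k)%N; rewrite mx; apply; lia.
split.
- rewrite word_moment0_split -conv; apply: eq_bigr => k _.
  by have [-> _ _] := IH k.
- rewrite word_moment1_split -conv; apply: eq_bigr => k _.
  by have [-> -> _] := IH k; rewrite cE -moment1_step; ring.
- rewrite word_moment2_split -conv; apply: eq_bigr => k _.
  by have [-> -> ->] := IH k; rewrite cE -moment2_step; ring.
Qed.

End Moments.

Arguments moment_coef0 {R}.

(** * From parking functions to parking words *)

Lemma is_parkingE n (p : n.-tuple nat) :
  is_parking p = (zeros p == 0%N) && parking_word 1 (unshift p).
Proof.
have -> : (zeros p == 0%N) = all (leq 1) p.
  by rewrite /zeros; elim: (val p) => [//|[|a] w IHw] //=.
rewrite /is_parking; case: (boolP (all (leq 1) p)) => //= p1.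
(* The bound i + 1 on the entry at index i is the case x = 2; without zeros, lowering every letter
   by 1 gives x = 1. *)
have <- : parking_word 2 p = parking_word 1 (unshift p).
  rewrite parking_word_unshift; congr parking_word.
  suff -> : zeros p = 0%N by [].
  apply/eqP; rewrite /zeros -leqn0 leqNgt -has_count -all_predC.
  by rewrite (eq_all (a2 := leq 1))//; case.
by rewrite parking_word_sort size_tuple; apply: eq_forallb => i; lia.
Qed.

Lemma parking_sumE (R : comNzRingType) n (h : nat -> R) :
  \sum_(p in parking_funs n) h (sumn (map val p)) =
  word_sum n n (fun w => if parking_word 1 w then h (sumn w + n)%N else 0).
Proof.
(* [F] vanishes unless k = 0, so a single term of [word_sum_split] survives. *)
pose F k w := if (k == 0%N) && parking_word 1 w then h (sumn w + size w)%N else 0.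
transitivity (word_sum n.+1 n (fun w => F (zeros w) (unshift w))).
  rewrite -word_sum_tuple big_mkcond; apply: eq_bigr => t _.
  rewrite inE is_parkingE /F sumn_unshift; congr (if _ then _ else _).
rewrite word_sum_split big_ord_recl /= bin0 mul1r subn0 big1 ?addr0.
  by apply: eq_word_sum => w sz_w; rewrite /F sz_w.
by move=> i _; rewrite word_sum0 ?mulr0.
Qed.

(** * Reduction to E1 at x = 1 *)

Section Reduction.
Variables (R : realType) (n : nat).
Let c : R := n.+1%:R.
Let y : R := exp_quot c 3 n.
Let z : R := exp_quot c 4 n.

Let c_neq0 : c != 0. Proof. by rewrite pnatr_eq0. Qed.

Let y_neq0 : y != 0.
Proof.
by rewrite /y exp_quot3 /exp_coef mulf_neq0 ?invr_eq0 ?fact_neq0 ?expf_neq0.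
Qed.

(** Substituting n = c - 1 in the Euler relation gives a recurrence in m that expresses every
    [exp_quot c m n] needed below through [y] and [z]. *)
Let exp_quot_x1 m :
  c * exp_quot c m n = exp_quot c m.+1 n
  + (m%:R - 2) * (exp_quot c m.+2 n - exp_quot c m.+1 n).
Proof.
have := exp_quot_euler c m n.
have -> : n%:R = c - 1 by rewrite /c -natr1 addrK.
move: (exp_quot c m.+1 _) (exp_quot c m.+2 _) (exp_quot c m _) => u v w e.
have -> : c * w = c * u - c * (u - w) by ring.
have -> : c * u = (c - 1) * u + u by ring.
by rewrite e; ring.
Qed.

Lemma E1E : E1 R n = - (n%:R / 2) + c / 2 * (z / y - 1).
Proof.
have -> : z = \sum_(0 <= k < n) c ^+ k / k`!%:R + y.
  rewrite /z /y [exp_quot c 4 n]/(partial_sum (exp_quot c 3) n) /partial_sum.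
  rewrite big_ord_recr big_mkord; congr (_ + _).
  by apply: eq_bigr => i _; rewrite exp_quot3.
rewrite /E1 mulrDl divff // addrK -/c factS natrM -/c.
rewrite /y exp_quot3 /exp_coef; have cn0 : c ^+ n != 0 by rewrite expf_neq0.
have := fact_neq0 R n.
by move: n`!%:R (c ^+ n) cn0 (\sum_(_ <= _ < _) _) => f d d0 s f0; field; rewrite f0 d0.
Qed.

Lemma moment0_x1 : exp_quot_comb c moment_coef0 n = y / c.
Proof.
rewrite comb_coef0; apply: (mulfI c_neq0).
by rewrite exp_quot_x1 subrr mul0r addr0 mulrC divfK.
Qed.

Let a2E : exp_quot c 2 n = y / c.
Proof. by rewrite -moment0_x1 comb_coef0. Qed.

Let a1E : exp_quot c 1 n = (2 * (y / c) - y) / c.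
Proof.
apply: (mulfI c_neq0); rewrite exp_quot_x1 a2E -/y.
by move: y c c_neq0 => u v v0; field.
Qed.

Let a0E : exp_quot c 0 n = (3 * ((2 * (y / c) - y) / c) - 2 * (y / c)) / c.
Proof.
apply: (mulfI c_neq0); rewrite exp_quot_x1 a1E a2E.
by move: y c c_neq0 => u v v0; field.
Qed.

Let a5E : exp_quot c 5 n = c * y.
Proof. by rewrite exp_quot_x1; ring. Qed.

Let a6E : exp_quot c 6 n = (c * z + c * y) / 2.
Proof. by rewrite /z exp_quot_x1 -a5E; field. Qed.

Let a7E : exp_quot c 7 n = (c * (c * y) + 2 * ((c * z + c * y) / 2)) / 3.
Proof. by rewrite -a6E -{1}a5E exp_quot_x1; field. Qed.

Let a8E : exp_quot c 8 n = (c * ((c * z + c * y) / 2)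
  + 3 * ((c * (c * y) + 2 * ((c * z + c * y) / 2)) / 3)) / 4.
Proof. by rewrite -a7E -{1}a6E exp_quot_x1; field. Qed.

Lemma moment1_x1 : exp_quot_comb c (moment_coef1 c) n =
  y / c * (n%:R * (n%:R - 1) / 2 - E1 R n).
Proof.
rewrite E1E; expand_comb; rewrite a1E a2E a5E -/y -/z.
have -> : n%:R = c - 1 by rewrite /c -natr1 addrK.
by move: c y z c_neq0 y_neq0 => C Y Z C0 Y0; field; rewrite C0 Y0.
Qed.

(** With S the sum of the shifted entries, Area = a - S and Area (Area - 1) = (a^2 - a) - (2 a - 1)
    S + S^2. *)
Lemma moment2_x1 : let a := n%:R * (n%:R - 1) / 2 in
  (a ^+ 2 - a) * (y / c) - (2 * a - 1) * exp_quot_comb c (moment_coef1 c) n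
  + exp_quot_comb c (moment_coef2 c) n =
  y / c * (- (7 / 3) * (n%:R + 1) * E1 R n
       + 5 / 12 * n%:R ^+ 3 - 1 / 12 * n%:R ^+ 2 - 1 / 3 * n%:R).
Proof.
rewrite /= moment1_x1 E1E; expand_comb.
rewrite a0E a1E a2E a5E a6E a7E a8E -/y -/z.
have -> : n%:R = c - 1 by rewrite /c -natr1 addrK.
by move: c y z c_neq0 y_neq0 => C Y Z C0 Y0; field; rewrite C0 Y0.
Qed.

End Reduction.

(** * Moments of the area and the error bound *)

Section AreaMoments.
Variables (R : realType) (n : nat).

Lemma area_sumn (p : n.-tuple nat) :
  area R p = n%:R * (n%:R + 1) / 2 - (sumn p)%:R.
Proof. by rewrite /area sumnE natr_sum big_tuple. Qed.

Lemma area_sum (h : R -> R) :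
  \sum_(p in parking_funs n) h (area R (map_tuple val p)) =
  word_sum n n (fun w => if parking_word 1 w
    then h (n%:R * (n%:R - 1) / 2 - (sumn w)%:R) else 0).
Proof.
under eq_bigr do rewrite area_sumn.
rewrite (parking_sumE n (fun s => h (n%:R * (n%:R + 1) / 2 - s%:R))).
apply: eq_word_sum => w _; case: ifP => // _; congr h.
by rewrite natrD; field.
Qed.

Let a : R := n%:R * (n%:R - 1) / 2.
Let M r : R := word_moment R r n n 1.
(** By [exp_quot3] this is (n + 1)^(n - 1). *)
Let p0 : R := n`!%:R * (exp_quot n.+1%:R 3 n / n.+1%:R).

Let ME : [/\ M 0 = p0, M 1 = p0 * (a - E1 R n) &
  (a ^+ 2 - a) * M 0 - (2 * a - 1) * M 1 + M 2 =
  p0 * (- (7 / 3) * (n%:R + 1) * E1 R n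
       + 5 / 12 * n%:R ^+ 3 - 1 / 12 * n%:R ^+ 2 - 1 / 3 * n%:R)].
Proof.
have le_n : (n + 1 <= n.+1)%N by rewrite addn1.
have [m0 m1 m2] := word_momentE R le_n.
rewrite /M m0 m1 m2 addn1 moment0_x1; split=> //.
  by rewrite moment1_x1 mulrA.
by rewrite /p0 -[RHS]mulrA -moment2_x1 /a; ring.
Qed.

Lemma card_parking_funs : #|parking_funs n|%:R = p0.
Proof.
have [<- _ _] := ME; rewrite -sumr_const.
exact: (area_sum (fun=> 1)).
Qed.

Let p0_neq0 : p0 != 0.
Proof.
rewrite /p0 exp_quot3 /exp_coef.
by rewrite !mulf_neq0 ?invr_eq0 ?fact_neq0 ?expf_neq0 ?pnatr_eq0.
Qed.

Lemma parking_expectation_area : parking_expectation (area R (n:=n)) = E1 R n.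
Proof.
rewrite /parking_expectation card_parking_funs (area_sum id).
have [m0 m1 _] := ME; apply: (mulIf p0_neq0); rewrite divfK//.
transitivity (a * M 0 + (- 1) * M 1); last by rewrite m0 m1; ring.
rewrite /M -!word_sumZ -word_sumD; apply: eq_word_sum => w _.
by case: ifP => _; rewrite /a; ring.
Qed.

Lemma area_moment2E : area_moment2 R n =
  - (7 / 3) * (n%:R + 1) * E1 R n
       + 5 / 12 * n%:R ^+ 3 - 1 / 12 * n%:R ^+ 2 - 1 / 3 * n%:R.
Proof.
rewrite /area_moment2 /parking_expectation card_parking_funs.
rewrite (area_sum (fun x => x * (x - 1))).
have [_ _ m2] := ME; apply: (mulIf p0_neq0); rewrite divfK// [RHS]mulrC -m2.
transitivity ((a ^+ 2 - a) * M 0 + (1 - 2 * a) * M 1 + M 2); last by ring.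
rewrite /M -!word_sumZ -!word_sumD; apply: eq_word_sum => w _.
by case: ifP => _; rewrite /a; ring.
Qed.

(** The difference of the two sides is the variance of the area. *)
Lemma E1_sqr_le : E1 R n ^+ 2 - E1 R n <= area_moment2 R n.
Proof.
have P0 : #|parking_funs n|%:R != 0 :> R by rewrite card_parking_funs.
rewrite -subr_ge0.
set X := fun p : n.-tuple nat => area R p; set mu := E1 R n.
have -> : area_moment2 R n - (mu ^+ 2 - mu) =
    parking_expectation (fun p : n.-tuple nat => (X p - mu) ^+ 2).
  have e1 : \sum_(p in parking_funs n) X (map_tuple val p) = mu * #|parking_funs n|%:R.
    by rewrite /mu -parking_expectation_area /parking_expectation divfK.
  apply: (mulIf P0); rewrite mulrBl /area_moment2 /parking_expectation !divfK//.
  transitivity (\sum_(p in parking_funs n)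
       (X (map_tuple val p) * (X (map_tuple val p) - 1))
     - (2 * mu - 1) * (\sum_(p in parking_funs n) X (map_tuple val p))
     + mu ^+ 2 * #|parking_funs n|%:R).
    by rewrite e1; ring.
  rewrite -sumr_const !mulr_sumr -sumrB -big_split /=.
  by apply: eq_bigr => p _; ring.
by rewrite divr_ge0// sumr_ge0// => p _; rewrite sqr_ge0.
Qed.

Lemma area_moment2_bound : (1 <= n)%N ->
  `|area_moment2 R n - 5 / 12 * n%:R ^+ 3| <= 25 * Num.sqrt n%:R ^+ 5.
Proof.
move=> n1; have := E1_sqr_le; rewrite area_moment2E.
set s : R := Num.sqrt n%:R.
have s1 : 1 <= s by rewrite -sqrtr1 ler_sqrt ?ler1n.
have -> : n%:R = s ^+ 2 :> R by rewrite sqr_sqrtr.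
move: (E1 R n) => E leE.
have s2 : 1 <= s ^+ 2 by rewrite exprn_ege1.
have s23 : s ^+ 2 <= s ^+ 3 by rewrite ler_weXn2l.
have s45 : s ^+ 4 <= s ^+ 5 by rewrite ler_weXn2l.
have s24 : s ^+ 2 <= s ^+ 4 by rewrite ler_weXn2l.
have s46 : s ^+ 4 <= s ^+ 6 by rewrite ler_weXn2l.
(* Completing the square: 2/3 + 7/6 s^2 is half of 7/3 (s^2 + 1) - 1, the coefficient of E once the
   closed form is moved to the left. The constant 9 is generous. *)
have sqrE : (E + (2 / 3 + 7 / 6 * s ^+ 2)) ^+ 2 <= (3 * s ^+ 3) ^+ 2.
  have -> : (3 * s ^+ 3) ^+ 2 = 9 * s ^+ 6 by ring.
  have -> : (E + (2 / 3 + 7 / 6 * s ^+ 2)) ^+ 2 =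
    E ^+ 2 - E + 7 / 3 * (s ^+ 2 + 1) * E
    + (4 / 9 + 14 / 9 * s ^+ 2 + 49 / 36 * s ^+ 4) by field.
  have -> : s ^+ 6 = (s ^+ 2) ^+ 3 by ring.
  have e46 : s ^+ 4 <= (s ^+ 2) ^+ 3 by rewrite -exprM.
  have e4 : (s ^+ 2) ^+ 2 = s ^+ 4 by ring.
  move: leE; rewrite e4; lra.
have absE : `|E + (2 / 3 + 7 / 6 * s ^+ 2)| <= 3 * s ^+ 3.
  by rewrite -ler_sqr ?nnegrE ?real_normK ?num_real//; nra.
have E5 : `|E| <= 5 * s ^+ 3.
  by move: absE; rewrite !ler_norml => /andP[? ?]; apply/andP; split; lra.
have sE : `|(s ^+ 2 + 1) * E| <= 10 * s ^+ 5.
  rewrite normrM ger0_norm; last by lra.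
  have -> : 10 * s ^+ 5 = (2 * s ^+ 2) * (5 * s ^+ 3) by ring.
  by apply: ler_pM => //; lra.
(* The final constant 25 covers 7/3 * 10 + 1/12 + 1/3. *)
have e4 : (s ^+ 2) ^+ 2 = s ^+ 4 by ring.
move: sE; rewrite !ler_norml e4 -!mulrA => /andP[? ?]; apply/andP; split; lra.
Qed.

End AreaMoments.

Theorem theorem2 (R : realType) :
  (forall n : nat, (1 <= n)%N ->
     area_moment2 R n =
       - (7 / 3) * (n%:R + 1) * E1 R n
       + 5 / 12 * n%:R ^+ 3 - 1 / 12 * n%:R ^+ 2 - 1 / 3 * n%:R)
  /\
  ((fun n : nat => area_moment2 R n : R^o)
     = (fun n : nat => 5 / 12 * n%:R ^+ 3 : R^o)
       +O_\oo (fun n : nat => n%:R `^ (5 / 2) : R^o)).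
Proof.
split=> [n _|]; first exact: area_moment2E.
apply/eqaddOP; near=> k; near=> n.
have n1 : (1 <= n)%N by near: n; exists 1%N.
have powE : n%:R `^ (5 / 2) = Num.sqrt n%:R ^+ 5 :> R.
  by rewrite mulrC powRrM powR12_sqrt// powR_mulrn// sqrtr_ge0.
have k25 : 25 <= k by near: k; apply: nbhs_pinfty_ge.
rewrite /= powE; apply: le_trans (area_moment2_bound R n1) _.
rewrite (ger0_norm (x := _ ^+ 5)) ?exprn_ge0 ?sqrtr_ge0//.
by rewrite ler_wpM2r// exprn_ge0 ?sqrtr_ge0.
Unshelve. all: by end_near. Qed.
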